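(* Let $l\ge 2$ be an integer, let $\lambda>\lambda_l$ and $p>2$. There is a constant $C_{l,\lambda,p}$, depending only on $l,\lambda,p$, such that for every $\lambda$-lacunary sequence of positive integers $\mathfrak N=\{n_k\}_{k\ge1}$ and every finite sum $$S(x)=\sum_{m\in \mathfrak N(l)}c_m e^{2\pi i m x}$$ (complex coefficients $c_m$, only finitely many of them nonzero) one has $$\|S\|_p\le C_{l,\lambda,p}\,\|S\|_2 .$$
   Context: Norms are those of $L^p(0,1)$ with Lebesgue measure. For an integer $l\ge 3$, $\lambda_l$ is the unique solution $x>1$ of $x^{l-1}=x^{l-2}+x^{l-3}+\dots+1$; for $l=2$, $\lambda_2=1$. For $\lambda>1$, a sequence of positive integers $\{n_k\}_{k\ge 1}$ is $\lambda$-lacunary if $n_{k+1}/n_k>\lambda$ for all $k\ge1$. For $\mathfrak N=\{n_k\}_{k\ge1}$, $\mathfrak N(l)$ is the set of all integers $m\in\mathbb Z$ that can be written as $m=\varepsilon_1 n_{k_1}+\varepsilon_2 n_{k_2}+\dots+\varepsilon_l n_{k_l}$ with $\varepsilon_j\in\{1,-1\}$ and indices $k_1>k_2>\dots>k_l\ge 1$. *)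

(* Defs.v *)
From HB Require Import structures.
From mathcomp Require Import all_boot all_order all_algebra.
From mathcomp Require Import all_classical all_reals all_analysis.
From mathcomp Require Import complex.

Set Implicit Arguments.
Unset Strict Implicit.
Unset Printing Implicit Defensive.

Import Order.TTheory GRing.Theory Num.Theory.
Import numFieldNormedType.Exports.

Local Open Scope classical_set_scope.
Local Open Scope ring_scope.

Definition threshold_eq (R : realType) (l : nat) (x : R) : Prop :=
  1 < x /\ x ^+ l.-1 = \sum_(i < l.-1) x ^+ i.

(* [threshold_eqE] below shows that the choice made by [xget] is the unique
   solution as soon as 3 <= l. *)
Definition threshold (R : realType) (l : nat) : R :=
  if l == 2%N then 1 else xget 1 [set x : R | threshold_eq l x].

Lemma threshold_eq_exists (R : realType) (l : nat) : (3 <= l)%N ->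
  exists x : R, threshold_eq l x.
Proof.
case: l => [|[|[|k]]] // _.
pose q : {poly R} := 'X^(k.+2) - \sum_(i < k.+2) 'X^i.
have qE x : q.[x] = x ^+ k.+2 - \sum_(i < k.+2) x ^+ i.
  rewrite /q hornerD hornerN hornerXn horner_sum.
  by under eq_bigr do rewrite hornerXn.
have q1 : q.[1] < 0.
  rewrite qE expr1n; under eq_bigr do rewrite expr1n.
  by rewrite sumr_const card_ord subr_lt0 ltr1n.
have q2 : q.[2] = 1.
  rewrite qE; have := subrX1 (2 : R) k.+2.
  have -> : (2 : R) - 1 = 1 by rewrite -[2]/(1 + 1) addrK.
  by rewrite mul1r => <-; rewrite opprB addrC subrK.
have [||x /andP[x1 _] qx] := @poly_ivt R q 1 2; first by rewrite ler1n.
  by rewrite q2 ltW//= ler01.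
exists x; split.
  by rewrite lt_neqAle x1 andbT; apply: contraTneq qx => <-; rewrite rootE lt_eqF.
by move/rootP: qx; rewrite qE => /eqP; rewrite subr_eq0 => /eqP.
Qed.

Lemma threshold_eq_unique (R : realType) (l : nat) (x y : R) : (3 <= l)%N ->
  threshold_eq l x -> threshold_eq l y -> x = y.
Proof.
case: l => [|[|[|k]]] // _.
wlog xy : x y / x < y => [H hx hy|[x1 /= hx] [y1 /= hy]].
  by have [/H->//|/H xy|] := ltgtP x y; first exact/esym/xy.
have x0 : 0 < x by exact: lt_trans x1.
have y0 : 0 < y by exact: lt_trans y1.
suff : y ^+ k.+2 * x ^+ k.+2 < x ^+ k.+2 * y ^+ k.+2 by rewrite mulrC ltxx.
rewrite {1}hy {2}hx !mulr_suml.
apply: ltr_sum => [|i _]; first by apply/hasP; exists ord0; rewrite ?mem_index_enum.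
case: i => i /= ik.
rewrite -(subnK (ltnW ik)) !exprD mulrCA [ltRHS]mulrCA.
rewrite [y ^+ i * x ^+ i]mulrC ltr_pM2r ?mulr_gt0 ?exprn_gt0//.
by rewrite ltrXn2r ?(ltW x0)// subn_eq0 -ltnNge.
Qed.

Lemma threshold_eqE (R : realType) (l : nat) (x : R) : (3 <= l)%N ->
  threshold_eq l x <-> x = threshold R l.
Proof.
move=> l3; have tP : threshold_eq l (threshold R l).
  rewrite /threshold gtn_eqF//.
  by have [y hy] := threshold_eq_exists R l3; exact: (@xgetPex _ 1 _ (ex_intro _ y hy)).
by split=> [hx|->//]; exact: threshold_eq_unique hx tP.
Qed.

(* Sequences are indexed from 0: [n k] is the term written n_{k+1} when the
   indexing starts at 1. *)
Definition lacunary (R : realType) (lam : R) (n : nat -> nat) : Prop :=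
  (forall k, (0 < n k)%N) /\
  (forall k, lam < (n k.+1)%:R / (n k)%:R).

Definition signed_sums (n : nat -> nat) (l : nat) : set int :=
  [set m | exists (eps : 'I_l -> int) (k : 'I_l -> nat),
    [/\ forall j, eps j = 1 \/ eps j = -1,
        forall i j : 'I_l, (i < j)%N -> (k j < k i)%N &
        m = \sum_(j < l) eps j * (n (k j))%:Z]].

Definition expi (R : realType) (t : R) : R[i] := (cos t +i* sin t)%C.

(* [\sum_(m \in A)] is the finitely supported sum of [fsbigop]: it is the
   expected finite sum when c has finitely many nonzero values on A. *)
Definition trig_sum (R : realType) (A : set int) (c : int -> R[i]) (x : R) :
    R[i] :=
  \sum_(m \in A) c m * expi (2 * pi * m%:~R * x).

Definition lebesgue01 (R : realType) :
    {measure set (measurableTypeR R) -> \bar R} :=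
  mrestr (@lebesgue_measure R) (measurable_itv `]0%R, 1%R[).

(* [Lnorm] is only available for extended-real-valued functions, hence the
   composition with the (real-valued) modulus [normc]. *)
Definition Lp01 (R : realType) (p : R) (f : R -> R[i]) : \bar R :=
  Lnorm (lebesgue01 R) p%:E (fun x => (ComplexField.Normc.normc (f x))%:E).

(* Main.v *)
(* By monotonicity of L^p norms take p = 2Q an even integer.  The hypothesis on
   lambda says that 1/lambda + ... + 1/lambda^(l-1) < 1, so every m in N(l) with
   leading index k satisfies delta n_k <= |m| <= 2 n_k for some delta > 0.  Split
   S into the blocks S_k of frequencies with leading index k, and the indices k
   into residue classes modulo a large N.  Inside one class the blocks behave
   like martingale differences: the frequencies of S_k are larger than 2Q - 1
   times those of the partial sum P of the previous blocks, so in the expansion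
   of |P + S_k|^(2Q) the part linear in S_k integrates to zero, and Hoelder's
   inequality gives ||P + S_k||_p^2 <= ||P||_p^2 + K ||S_k||_p^2.  Summing,
   ||S||_p^2 <= C sum_k ||S_k||_p^2.  Finally S_k is the sum of two polynomials
   with frequencies in N(l-1), shifted by n_k and -n_k, and one concludes by
   induction on l, starting from N(0) = {0}, and Parseval's identity. *)
Require Import Defs.
From mathcomp Require Import all_boot all_order all_algebra.
From mathcomp Require Import all_classical all_reals all_analysis.
From mathcomp Require Import complex.
From mathcomp Require Import measurable_realfun.
From mathcomp Require Import ring lra zify.

Import Order.TTheory GRing.Theory Num.Theory.
Import numFieldNormedType.Exports.
Local Open Scope classical_set_scope.
Local Open Scope ring_scope.

Set Implicit Arguments.
Unset Strict Implicit.
Unset Printing Implicit Defensive.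

(** * Inequalities between powers of nonnegative reals *)

Lemma exprM_le_add (R : realDomainType) (a b : R) (i j : nat) :
  0 <= a -> 0 <= b -> a ^+ i * b ^+ j <= a ^+ (i + j) + b ^+ (i + j).
Proof.
move=> a0 b0; have [ab|/ltW ba] := leP a b.
- apply: (@le_trans _ _ (b ^+ (i + j))); last by rewrite lerDr exprn_ge0.
  by rewrite exprD ler_wpM2r ?exprn_ge0// lerXn2r.
- apply: (@le_trans _ _ (a ^+ (i + j))); last by rewrite lerDl exprn_ge0.
  by rewrite exprD ler_wpM2l ?exprn_ge0// lerXn2r.
Qed.

(* With u = |a|^2, v = |b|^2 and w = 2 Re (conj a * b), the left-hand side is
   |a + b|^(2q + 2). *)
Lemma expr_smooth (R : realFieldType) (q : nat) : exists2 K : R, 1 <= K &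
  forall u v w : R, 0 <= u -> 0 <= v -> w ^+ 2 <= 4 * (u * v) ->
  (u + w + v) ^+ q.+1 <=
  u ^+ q.+1 + q.+1%:R * (u ^+ q * w) + K * (u ^+ q * v + v ^+ q.+1).
Proof.
elim: q => [|q [K K1 IH]].
  by exists 1 => // u v w u0 v0 w4; rewrite !expr1 !expr0; lra.
(* The induction multiplies the previous bound by [u + w + v]. The old remainder costs [6 * K],
   since [u + w + v <= 2 * (u + v)]. The quadratic term costs [4 * q.+1%:R], the term in
   [u ^+ q * v * w] another [2 * q.+1%:R], and [u ^+ q.+1 * v] the final 1. *)
exists (6 * K + 6 * q.+1%:R + 1) => [|u v w u0 v0 w4].
  by have : (0 : R) <= q.+1%:R by []; lra.
have wuv : `|w| <= u + v.
  rewrite -ler_sqr ?nnegrE ?addr_ge0// real_normK ?num_real//.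
  apply: le_trans w4 _; rewrite -subr_ge0 (_ : _ - _ = (u - v) ^+ 2) ?sqr_ge0//.
  by ring.
have [wl wu] : - (u + v) <= w /\ w <= u + v by apply/andP; rewrite -ler_norml.
have x0 : 0 <= u + w + v by lra.
have := IH u v w u0 v0 w4.
move/(ler_wpM2l x0); rewrite -exprS => /le_trans; apply.
have uq := exprn_ge0 q u0.
have vq := exprn_ge0 q v0.
have h1 : u ^+ q * w ^+ 2 <= 4 * (u ^+ q.+1 * v).
  apply: le_trans (ler_wpM2l uq w4) _.
  by rewrite exprS le_eqVlt; apply/orP; left; apply/eqP; ring.
have h3 : u ^+ q * v ^+ 2 <= u ^+ q.+1 * v + v ^+ q.+2.
  have := ler_wpM2r v0 (@exprM_le_add _ u v q 1 u0 v0).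
  by rewrite addn1 expr1 mulrDl -mulrA -expr2 -exprSr.
have h4 : u * v ^+ q.+1 <= u ^+ q.+1 * v + v ^+ q.+2.
  have := ler_wpM2r v0 (@exprM_le_add _ u v 1 q u0 v0).
  by rewrite add1n expr1 mulrDl -mulrA -exprSr -exprSr.
have h5 : u ^+ q * v * w <= u ^+ q * v * (u + v) by rewrite ler_wpM2l ?mulr_ge0.
have q0 : (0 : R) <= q.+1%:R by [].
have hq1 := ler_wpM2l q0 h1.
have hq3 := ler_wpM2l q0 h3.
have hq5 := ler_wpM2l q0 h5.
have Z0 : 0 <= u ^+ q * v + v ^+ q.+1 by rewrite addr_ge0 ?mulr_ge0 ?exprn_ge0.
have K0 : 0 <= K by lra.
have hK : (u + w + v) * (K * (u ^+ q * v + v ^+ q.+1)) <=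
          6 * K * (u ^+ q.+1 * v + v ^+ q.+2).
  have : (u + w + v) * (u ^+ q * v + v ^+ q.+1) <=
          (2 * u + 2 * v) * (u ^+ q * v + v ^+ q.+1).
    by rewrite ler_wpM2r//; lra.
  have -> : (2 * u + 2 * v) * (u ^+ q * v + v ^+ q.+1) =
     2 * (u ^+ q.+1 * v + v ^+ q.+2 + u ^+ q * v ^+ 2 + u * v ^+ q.+1).
    by rewrite !exprS; ring.
  move=> h; have h6 : (u + w + v) * (u ^+ q * v + v ^+ q.+1) <=
       6 * (u ^+ q.+1 * v + v ^+ q.+2) by lra.
  by rewrite mulrCA [6 * K]mulrC -mulrA ler_wpM2l.
rewrite mulrDr.
have -> : (u + w + v) * (u ^+ q.+1 + q.+1%:R * (u ^+ q * w)) =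
  u ^+ q.+2 + q.+2%:R * (u ^+ q.+1 * w) + q.+1%:R * (u ^+ q * w ^+ 2) +
  u ^+ q.+1 * v + q.+1%:R * (u ^+ q * v * w).
  by rewrite !exprS -[q.+2%:R]natr1; ring.
have e5 : u ^+ q * v * (u + v) = u ^+ q.+1 * v + u ^+ q * v ^+ 2.
  by rewrite exprS; ring.
rewrite e5 in hq5.
have W0 : 0 <= v ^+ q.+2 by rewrite exprn_ge0.
move: hK hq1 hq3 hq5 W0 (mulr_ge0 q0 W0).
rewrite !mulrDr !mulrDl !mulrDr; lra.
Qed.

(** * Means of continuous functions over the unit interval *)

Definition mean01 (R : realType) (f : R -> R) : R :=
  \int[@lebesgue_measure R]_(x in `[0, 1]) f x.

Section Mean.
Variable R : realType.
Implicit Types f g : R -> R.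
Local Notation mu := (@lebesgue_measure R).

Lemma continuous_integrable01 f : continuous f ->
  mu.-integrable `[0, 1] (EFin \o f).
Proof.
move=> cf; apply: continuous_compact_integrable; first exact: segment_compact.
exact: continuous_subspaceT.
Qed.

Lemma mean01D f g : continuous f -> continuous g ->
  mean01 (fun x => f x + g x) = mean01 f + mean01 g.
Proof.
by move=> cf cg; rewrite /mean01 RintegralD//; exact: continuous_integrable01.
Qed.

Lemma mean01Z f (a : R) : continuous f ->
  mean01 (fun x => a * f x) = a * mean01 f.
Proof. by move=> cf; rewrite /mean01 RintegralZl//; exact: continuous_integrable01. Qed.

Lemma le_mean01 f g : continuous f -> continuous g ->
  (forall x, f x <= g x) -> mean01 f <= mean01 g.
Proof.
by move=> cf cg fg; apply: le_Rintegral => //; exact: continuous_integrable01.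
Qed.

Lemma mean01_cst (a : R) : mean01 (fun=> a) = a.
Proof.
rewrite /mean01 Rintegral_cst//= lebesgue_measure_itv/= lte01.
by rewrite sube0 mulr1.
Qed.

Lemma continuous_funD f g : continuous f -> continuous g ->
  continuous (fun x => f x + g x).
Proof. by move=> cf cg x; apply: (@continuousD _ _ _ f g); [exact: cf|exact: cg]. Qed.

Lemma continuous_funB f g : continuous f -> continuous g ->
  continuous (fun x => f x - g x).
Proof. by move=> cf cg x; apply: (@continuousB _ _ _ f g); [exact: cf|exact: cg]. Qed.

Lemma continuous_funM f g : continuous f -> continuous g ->
  continuous (fun x => f x * g x).
Proof. by move=> cf cg x; apply: (@continuousM _ _ f g); [exact: cf|exact: cg]. Qed.

Lemma continuous_funZ f (a : R) : continuous f -> continuous (fun x => a * f x).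
Proof. by apply: continuous_funM => x; exact: cst_continuous. Qed.

Lemma continuous_funX f (q : nat) : continuous f -> continuous (fun x => f x ^+ q).
Proof.
move=> cf; elim: q => [|q IH].
  by under eq_fun do rewrite expr0; move=> x; exact: cst_continuous.
by under eq_fun do rewrite exprS; exact: continuous_funM.
Qed.

Lemma continuous_bigsum (I : Type) (s : seq I) (F : I -> R -> R) :
  (forall i, continuous (F i)) -> continuous (fun x => \sum_(i <- s) F i x).
Proof.
move=> cF; elim: s => [|i s IH].
  by under eq_fun do rewrite big_nil; move=> x; exact: cst_continuous.
by under eq_fun do rewrite big_cons; exact: continuous_funD.
Qed.

Lemma mean01_sum (I : Type) (s : seq I) (F : I -> R -> R) :
  (forall i, continuous (F i)) ->
  mean01 (fun x => \sum_(i <- s) F i x) = \sum_(i <- s) mean01 (F i).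
Proof.
move=> cF; elim: s => [|i s IH].
  rewrite big_nil -[RHS](mean01_cst 0); congr mean01.
  by apply/funext => x; rewrite big_nil.
rewrite big_cons -IH -mean01D//.
  by congr mean01; apply/funext => x; rewrite big_cons.
exact: continuous_bigsum.
Qed.

Lemma mean01_derive f F : continuous f ->
  (forall x : R, is_derive x 1 F (f x)) -> mean01 f = F 1 - F 0.
Proof.
move=> cf dF; rewrite /mean01 /Rintegral (@continuous_FTC2 _ _ F)//=.
- exact: continuous_subspaceT.
- have cF : continuous F.
    move=> x; apply: differentiable_continuous.
    by apply/derivable1_diffP; exact: ex_derive.
  by split => [x _||]; [exact: ex_derive|apply: cvg_at_right_filter|
    apply: cvg_at_left_filter]; exact: cF.
- by move=> x _; rewrite derive1E; exact: derive_val.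
Qed.

Lemma sin_2pi_int (m : int) : sin (2 * pi * m%:~R) = 0 :> R.
Proof.
have h (n : nat) : sin (2 * pi * n%:R) = 0 :> R.
  have := periodicn (@sinD2pi R) n 0.
  by rewrite add0r sin0 => <-; congr sin; rewrite mulr_natr [2 * pi]mulr_natl.
case: m => n; first exact: h.
by rewrite NegzE mulrNz mulrN sinN h oppr0.
Qed.

Lemma cos_2pi_int (m : int) : cos (2 * pi * m%:~R) = 1 :> R.
Proof.
have h (n : nat) : cos (2 * pi * n%:R) = 1 :> R.
  have := periodicn (@cosD2pi R) n 0.
  by rewrite add0r cos0 => c1; rewrite -[RHS]c1; congr cos;
    rewrite mulr_natr [2 * pi]mulr_natl.
case: m => n; first exact: h.
by rewrite NegzE mulrNz mulrN cosN h.
Qed.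

Lemma continuous_cosM (a : R) : continuous (fun x => cos (a * x)).
Proof.
move=> x; apply: (@continuous_comp _ _ _ ( *%R a) cos); last exact: continuous_cos.
exact: mulrl_continuous.
Qed.

Lemma continuous_sinM (a : R) : continuous (fun x => sin (a * x)).
Proof.
move=> x; apply: (@continuous_comp _ _ _ ( *%R a) sin); last exact: continuous_sin.
exact: mulrl_continuous.
Qed.

Lemma mean01_cos (m : int) : m != 0 ->
  mean01 (fun x : R => cos (2 * pi * m%:~R * x)) = 0.
Proof.
move=> m0; set a : R := 2 * pi * m%:~R.
have a0 : a != 0 by rewrite !mulf_neq0 ?pnatr_eq0 ?intr_eq0 ?(gt_eqF (pi_gt0 R)).
have dF (x : R) : is_derive x 1 (fun x => a^-1 * sin (a * x)) (cos (a * x)).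
  apply: is_derive_eq; rewrite /GRing.scale/=.
  by rewrite mulr1 mulrCA mulVf// mulr1.
rewrite (mean01_derive (@continuous_cosM a) dF).
by rewrite mulr1 sin_2pi_int !mulr0 sin0 mulr0 subr0.
Qed.

Lemma mean01_sin (m : int) : mean01 (fun x : R => sin (2 * pi * m%:~R * x)) = 0.
Proof.
have [->|m0] := eqVneq m 0.
  rewrite -[RHS](mean01_cst 0); congr mean01.
  by apply/funext => x; rewrite mulr0 mul0r sin0.
set a : R := 2 * pi * m%:~R.
have a0 : a != 0 by rewrite !mulf_neq0 ?pnatr_eq0 ?intr_eq0 ?(gt_eqF (pi_gt0 R)).
have dF (x : R) : is_derive x 1 (fun x => - a^-1 * cos (a * x)) (sin (a * x)).
  apply: is_derive_eq; rewrite /GRing.scale/=.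
  by rewrite mulr1 mulNr mulNr mulrN opprK mulrCA mulVf// mulr1.
rewrite (mean01_derive (@continuous_sinM a) dF).
by rewrite mulr1 cos_2pi_int mulr0 cos0 subrr.
Qed.
End Mean.

(** * Trigonometric polynomials and their spectra *)

Section TrigPolynomials.
Variable R : realType.
Implicit Types (f g : R -> R[i]) (A B : set int) (z w : R[i]).

Definition harm (m : int) (x : R) : R[i] := expi (2 * pi * m%:~R * x).

(** A real polynomial in the two parts of [z]: its powers give even powers of the modulus without
    square roots. *)
Definition sqmod z : R := complex.Re z ^+ 2 + complex.Im z ^+ 2.

Definition cross z w : R :=
  2 * (complex.Re z * complex.Re w + complex.Im z * complex.Im w).

Lemma harm0 (x : R) : harm 0 x = 1.
Proof. by rewrite /harm /expi mulr0 mul0r cos0 sin0. Qed.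

Lemma harmD (m n : int) (x : R) : harm (m + n) x = harm m x * harm n x.
Proof.
rewrite /harm /expi rmorphD/= mulrDr mulrDl cosD sinD.
by apply/eqP; rewrite eq_complex/= eqxx/= addrC eqxx.
Qed.

Lemma harmN (m : int) (x : R) : harm (- m) x = conjc (harm m x).
Proof. by rewrite /harm /expi/= mulrNz mulrN mulNr cosN sinN. Qed.

Lemma sqmod_ge0 z : 0 <= sqmod z.
Proof. by rewrite addr_ge0 ?sqr_ge0. Qed.

Lemma sqmod0 : sqmod 0 = 0.
Proof. by rewrite /sqmod/= expr0n/= addr0. Qed.

Lemma sqmodM z w : sqmod (z * w) = sqmod z * sqmod w.
Proof. by case: z w => [a b] [c d]; rewrite /sqmod/=; ring. Qed.

Lemma sqmodD z w : sqmod (z + w) = sqmod z + cross z w + sqmod w.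
Proof. by case: z w => [a b] [c d]; rewrite /sqmod /cross/=; ring. Qed.

Lemma sqmod_harm (m : int) (x : R) : sqmod (harm m x) = 1.
Proof. by rewrite /sqmod/= cos2Dsin2. Qed.

Lemma sqmodC z : (sqmod z)%:C%C = z * conjc z.
Proof.
case: z => a b; apply/eqP; rewrite eq_complex/=; apply/andP; split; apply/eqP;
  rewrite /sqmod/=; ring.
Qed.

(** Cauchy-Schwarz in the plane, by Lagrange's identity: the gap is the square of twice the
    determinant. This supplies the hypothesis on [w] in [expr_smooth]. *)
Lemma cross_sqr_le z w : cross z w ^+ 2 <= 4 * (sqmod z * sqmod w).
Proof.
rewrite -subr_ge0; case: z w => [a b] [c d]; rewrite /cross /sqmod/=.
rewrite (_ : _ - _ = (2 * (a * d - b * c)) ^+ 2) ?sqr_ge0//; ring.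
Qed.

Lemma cross_Re z w : cross z w = complex.Re (2 * conjc z * w).
Proof. by case: z w => [a b] [c d]; rewrite /cross/=; ring. Qed.

Lemma sqmod_eq0 z : sqmod z = 0 -> z = 0.
Proof.
case: z => a b /eqP; rewrite paddr_eq0 ?sqr_ge0// !sqrf_eq0/= => /andP[/eqP-> /eqP->].
by [].
Qed.

(** Spectrum contained in [A], witnessed by a list of coefficient-frequency pairs. Frequencies may
    repeat in the list, so that sums are concatenations and products are lists of all pairs. *)
Definition band A f := exists2 t : seq (R[i] * int),
  (forall a, a \in t -> A a.2) &
  forall x, f x = \sum_(a <- t) a.1 * harm a.2 x.

Lemma eq_band A f g : f =1 g -> band A f -> band A g.
Proof. by move=> fg [t At ft]; exists t => // x; rewrite -fg. Qed.

Lemma sub_band A B f : A `<=` B -> band A f -> band B f.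
Proof. by move=> AB [t At ft]; exists t => // a /At/AB. Qed.

Lemma band0 A : band A (fun=> 0).
Proof. by exists [::] => // x; rewrite big_nil. Qed.

Lemma band_harm A (c : R[i]) (m : int) : A m -> band A (fun x => c * harm m x).
Proof.
move=> Am; exists [:: (c, m)] => [a|x]; last by rewrite big_seq1.
by rewrite inE => /eqP->.
Qed.

Lemma band_cst A (c : R[i]) : A 0 -> band A (fun=> c).
Proof. by move=> /(band_harm c); apply: eq_band => x; rewrite harm0 mulr1. Qed.

Lemma bandD A f g : band A f -> band A g -> band A (fun x => f x + g x).
Proof.
move=> [s As fs] [t At gt]; exists (s ++ t) => [a|x].
  by rewrite mem_cat => /orP[/As|/At].
by rewrite big_cat/= fs gt.
Qed.

Lemma band_sum A (I : eqType) (s : seq I) (P : pred I) (F : I -> R -> R[i]) :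
  (forall i, i \in s -> P i -> band A (F i)) ->
  band A (fun x => \sum_(i <- s | P i) F i x).
Proof.
elim: s => [|i s IH] AF.
  by apply: eq_band (band0 A) => x; rewrite big_nil.
have /IH {}IH j : j \in s -> P j -> band A (F j).
  by move=> js; apply: AF; rewrite inE js orbT.
have [Pi|Pi] := boolP (P i).
  have Ai : band A (F i) by apply: AF; rewrite ?mem_head.
  by apply: eq_band (bandD Ai IH) => x; rewrite big_cons Pi.
by apply: eq_band IH => x; rewrite big_cons (negbTE Pi).
Qed.

Lemma bandM A B C f g : (forall a b, A a -> B b -> C (a + b)) ->
  band A f -> band B g -> band C (fun x => f x * g x).
Proof.
move=> ABC [s As fs] [t Bt gt].
exists [seq (a.1 * b.1, a.2 + b.2) | a <- s, b <- t] => [c|x].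
  by case/allpairsP => -[a b] [/= /As Aa /Bt Bb ->]; exact: ABC.
rewrite fs gt big_distrlr big_allpairs_dep/=; apply: eq_bigr => a _.
by apply: eq_bigr => b _; rewrite harmD mulrACA.
Qed.

Lemma band_conj A B f : (forall a, A a -> B (- a)) ->
  band A f -> band B (fun x => conjc (f x)).
Proof.
move=> AB [s As fs]; exists [seq (conjc a.1, - a.2) | a <- s] => [c|x].
  by case/mapP => a /As/AB ? ->.
by rewrite fs rmorph_sum big_map/=; apply: eq_bigr => a _; rewrite harmN -rmorphM.
Qed.

Lemma Re_sum (I : Type) (s : seq I) (F : I -> R[i]) :
  complex.Re (\sum_(i <- s) F i) = \sum_(i <- s) complex.Re (F i).
Proof. by apply: (big_morph (@complex.Re R)) => [[a b] [c d]|]. Qed.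

Lemma Im_sum (I : Type) (s : seq I) (F : I -> R[i]) :
  complex.Im (\sum_(i <- s) F i) = \sum_(i <- s) complex.Im (F i).
Proof. by apply: (big_morph (@complex.Im R)) => [[a b] [c d]|]. Qed.

Lemma continuous_Re_harm (c : R[i]) (m : int) :
  continuous (fun x : R => complex.Re (c * harm m x)).
Proof.
case: c => a b /=; apply: continuous_funB; apply: continuous_funZ;
  by [exact: continuous_cosM|exact: continuous_sinM].
Qed.

Lemma continuous_Im_harm (c : R[i]) (m : int) :
  continuous (fun x : R => complex.Im (c * harm m x)).
Proof.
case: c => a b /=; apply: continuous_funD; apply: continuous_funZ;
  by [exact: continuous_cosM|exact: continuous_sinM].
Qed.

Lemma band_continuous_Re A f : band A f -> continuous (fun x => complex.Re (f x)).
Proof.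
move=> [t _ ft]; rewrite (_ : (fun _ => _) =
    fun x => \sum_(a <- t) complex.Re (a.1 * harm a.2 x)).
  by apply: continuous_bigsum => a; exact: continuous_Re_harm.
by apply/funext => x; rewrite ft Re_sum.
Qed.

Lemma band_continuous_Im A f : band A f -> continuous (fun x => complex.Im (f x)).
Proof.
move=> [t _ ft]; rewrite (_ : (fun _ => _) =
    fun x => \sum_(a <- t) complex.Im (a.1 * harm a.2 x)).
  by apply: continuous_bigsum => a; exact: continuous_Im_harm.
by apply/funext => x; rewrite ft Im_sum.
Qed.

Lemma continuous_sqmod A f : band A f -> continuous (fun x => sqmod (f x)).
Proof.
move=> Af; apply: continuous_funD; apply: continuous_funX.
  exact: band_continuous_Re Af.
exact: band_continuous_Im Af.
Qed.

Lemma continuous_sqmodX A f (q : nat) : band A f ->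
  continuous (fun x => sqmod (f x) ^+ q).
Proof. by move=> /continuous_sqmod; exact: continuous_funX. Qed.

(** Every nonconstant harmonic has mean 0. The real part suffices because both uses, in
    [mean01_cross0] and [parseval], start from a cross term. *)
Lemma mean01_band f : band [set m | m != 0] f ->
  mean01 (fun x => complex.Re (f x)) = 0.
Proof.
move=> [t t0 ft]; under [X in mean01 X]eq_fun do rewrite ft Re_sum.
rewrite mean01_sum => [|a]; last exact: continuous_Re_harm.
rewrite big_seq big1// => -[[a b] m] /t0/= m0.
under [X in mean01 X]eq_fun do rewrite -mulNr.
rewrite mean01D.
- rewrite !mean01Z ?mean01_cos ?mean01_sin ?mulr0 ?addr0//.
    exact: continuous_sinM.
  exact: continuous_cosM.
- exact/continuous_funZ/continuous_cosM.
- exact/continuous_funZ/continuous_sinM.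
Qed.

End TrigPolynomials.

(** * Martingale-type estimate for widely separated frequency blocks *)

Section SquareFunction.
Variable R : realType.
Implicit Types (f g P F : R -> R[i]) (u v : R -> R) (A B : set int).


Lemma band_sqmod P (D : nat) : band [set m : int | (`|m| <= D)%N] P ->
  band [set m : int | (`|m| <= D.*2)%N] (fun x => (sqmod (P x))%:C%C).
Proof.
move=> bP; under [X in band _ X]eq_fun do rewrite sqmodC.
apply: (bandM (A := [set m : int | (`|m| <= D)%N])
  (B := [set m : int | (`|m| <= D)%N])) => //=; first by move=> a b; lia.
by apply: band_conj bP => a /=; rewrite abszN.
Qed.

Lemma band_sqmodX P (D q : nat) : band [set m : int | (`|m| <= D)%N] P ->
  band [set m : int | (`|m| <= q * D.*2)%N] (fun x => (sqmod (P x) ^+ q)%:C%C).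
Proof.
move=> /band_sqmod bP; elim: q => [|q IH].
  by under [X in band _ X]eq_fun do rewrite expr0; exact: band_cst.
under [X in band _ X]eq_fun do rewrite exprS rmorphM/=.
by apply: bandM bP IH => a b /=; rewrite mulSn; lia.
Qed.

(** The factor [|P|^(2q) conj P] is a product of [2q + 1] polynomials of degree at most [D], so its
    frequencies stay below those of [F] in absolute value, and the product with [F] has no constant
    term. *)
Lemma mean01_cross0 P F (D q : nat) :
  band [set m : int | (`|m| <= D)%N] P ->
  band [set m : int | (q.*2.+1 * D < `|m|)%N] F ->
  mean01 (fun x => sqmod (P x) ^+ q * cross (P x) (F x)) = 0.
Proof.
move=> bP bF.
have e x : sqmod (P x) ^+ q * cross (P x) (F x) =
    complex.Re ((sqmod (P x) ^+ q)%:C%C * (2 * conjc (P x) * F x)).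
  rewrite cross_Re; case: (2 * _ * _) => a b /=; ring.
under [X in mean01 X]eq_fun do rewrite e.
apply: mean01_band.
have bC : band [set m : int | (`|m| <= D)%N] (fun x => conjc (P x)).
  by apply: band_conj bP => a /=; rewrite abszN.
have bC2 : band [set m : int | (`|m| <= D)%N] (fun x => 2 * conjc (P x)).
  apply: bandM (@band_cst _ [set m : int | m = 0] 2 erefl) bC => a b /= ->.
  by rewrite add0r.
have b1 : band [set m : int | (`|m| <= q.*2.+1 * D)%N]
    (fun x => (sqmod (P x) ^+ q)%:C%C * (2 * conjc (P x))).
  by apply: bandM (band_sqmodX q bP) bC2 => a b /=; rewrite -!mul2n; nia.
under [X in band _ X]eq_fun do rewrite mulrA.
apply: bandM b1 bF => a b /= h1 h2; apply/eqP => ab.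
by have : absz a = absz b; lia.
Qed.

(** Hoelder's inequality with exponents [(q + 1) / q] and [q + 1], up to the factor 2: normalize to
    [u / X] and [v / Y], apply [exprM_le_add] pointwise and integrate. *)
Lemma mean01_exprM_le u v (X Y : R) (q : nat) : 0 < X -> 0 < Y ->
  continuous u -> continuous v -> (forall x, 0 <= u x) -> (forall x, 0 <= v x) ->
  mean01 (fun x => u x ^+ q.+1) <= X ^+ q.+1 ->
  mean01 (fun x => v x ^+ q.+1) <= Y ^+ q.+1 ->
  mean01 (fun x => u x ^+ q * v x) <= 2 * (X ^+ q * Y).
Proof.
move=> X0 Y0 cu cv u0 v0 uX vY.
have cuq := @continuous_funX _ _ q.+1 cu.
have cvq := @continuous_funX _ _ q.+1 cv.
have Xq : 0 < X ^+ q.+1 by rewrite exprn_gt0.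
have Yq : 0 < Y ^+ q.+1 by rewrite exprn_gt0.
have XY : 0 < X ^+ q * Y by rewrite mulr_gt0 ?exprn_gt0.
apply: (@le_trans _ _ (mean01 (fun x => X ^+ q * Y * (X ^+ q.+1)^-1 * u x ^+ q.+1 +
   X ^+ q * Y * (Y ^+ q.+1)^-1 * v x ^+ q.+1))).
  apply: le_mean01 => [||x].
  - by apply: continuous_funM => //; exact: continuous_funX.
  - by apply: continuous_funD; exact: continuous_funZ.
  - have := @exprM_le_add _ (u x / X) (v x / Y) q 1
      (divr_ge0 (u0 x) (ltW X0)) (divr_ge0 (v0 x) (ltW Y0)).
    rewrite addn1 expr1 !expr_div_n mulrACA -invfM.
    rewrite ler_pdivrMr// => /le_trans; apply.
    by rewrite le_eqVlt; apply/orP; left; apply/eqP; ring.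
rewrite mean01D; [|exact: continuous_funZ..].
rewrite !mean01Z// -!mulrA -!mulrDr (mulrA _ Y) [2 * _]mulrC ler_wpM2l ?(ltW XY)//.
rewrite -[2]/(1 + 1) lerD// mulrC ler_pdivrMr// mul1r//.
Qed.

(* The part of |P + F|^(2q + 2) that is linear in F has no constant Fourier
   coefficient, as for a martingale difference; this is what makes the squares
   of the norms add up. *)
Lemma mean01_martingale_step (q : nat) : exists2 K : R, 0 <= K &
  forall P F (D : nat) (X Y : R), 0 < X -> 0 < Y ->
  band [set m : int | (`|m| <= D)%N] P ->
  band [set m : int | (q.*2.+1 * D < `|m|)%N] F ->
  mean01 (fun x => sqmod (P x) ^+ q.+1) <= X ^+ q.+1 ->
  mean01 (fun x => sqmod (F x) ^+ q.+1) <= Y ^+ q.+1 ->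
  mean01 (fun x => sqmod (P x + F x) ^+ q.+1) <= (X + K * Y) ^+ q.+1.
Proof.
have [K K1 HK] := @expr_smooth R q.
exists (4 * K) => [|P F D X Y X0 Y0 bP bF PX FY]; first by lra.
have cP := continuous_sqmod bP.
have cF := continuous_sqmod bF.
have cPF : continuous (fun x => cross (P x) (F x)).
  apply/continuous_funZ/continuous_funD; apply: continuous_funM.
  - exact: band_continuous_Re bP.
  - exact: band_continuous_Re bF.
  - exact: band_continuous_Im bP.
  - exact: band_continuous_Im bF.
have mixed := mean01_exprM_le X0 Y0 cP cF (fun x => sqmod_ge0 (P x))
  (fun x => sqmod_ge0 (F x)) PX FY.
have cPX := @continuous_funX _ _ q cP.
have cPX1 := @continuous_funX _ _ q.+1 cP.
have cFX1 := @continuous_funX _ _ q.+1 cF.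
apply: (@le_trans _ _ (X ^+ q.+1 + K * (2 * (X ^+ q * Y) + Y ^+ q.+1))).
  apply: (@le_trans _ _ (mean01 (fun x => sqmod (P x) ^+ q.+1 +
    (q.+1%:R * (sqmod (P x) ^+ q * cross (P x) (F x)) +
     K * (sqmod (P x) ^+ q * sqmod (F x) + sqmod (F x) ^+ q.+1))))).
    apply: le_mean01 => [||x].
    - under eq_fun do rewrite sqmodD.
      by apply/continuous_funX/continuous_funD => //; exact: continuous_funD.
    - apply: continuous_funD => //; apply: continuous_funD; apply: continuous_funZ.
        exact: continuous_funM.
      by apply: continuous_funD => //; exact: continuous_funM.
    - have := HK _ _ _ (sqmod_ge0 (P x)) (sqmod_ge0 (F x)) (cross_sqr_le (P x) (F x)).
      by rewrite -sqmodD => /le_trans; apply; rewrite addrA.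
  have c1 : continuous (fun x => sqmod (P x) ^+ q * cross (P x) (F x)).
    exact: continuous_funM.
  have c2 : continuous (fun x => sqmod (P x) ^+ q * sqmod (F x)).
    exact: continuous_funM.
  have c3 : continuous (fun x => sqmod (P x) ^+ q * sqmod (F x) + sqmod (F x) ^+ q.+1).
    exact: continuous_funD.
  rewrite mean01D//; last first.
    by apply: continuous_funD; exact: continuous_funZ.
  rewrite mean01D; [|exact: continuous_funZ..].
  rewrite !mean01Z// (mean01_cross0 bP bF) mulr0 add0r lerD//.
  by rewrite ler_wpM2l//; [lra|rewrite mean01D// lerD].
have XqY : 0 <= X ^+ q * Y by rewrite mulr_ge0 ?exprn_ge0 ?ltW.
have Yq : 0 <= Y ^+ q.+1 by rewrite exprn_ge0 ?ltW.
have Y0' := ltW Y0; have X0' := ltW X0.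
have KY : 0 <= 4 * K * Y by rewrite mulr_ge0//; lra.
have Xq : 0 <= X ^+ q by rewrite exprn_ge0.
set Z := X + 4 * K * Y.
have Z0 : 0 <= Z by rewrite addr_ge0.
have XZ : X ^+ q <= Z ^+ q by rewrite lerXn2r// lerDl.
have YZ : Y ^+ q <= Z ^+ q.
  rewrite lerXn2r//; apply: (@le_trans _ _ (4 * K * Y)); last by rewrite lerDr.
  by rewrite ler_peMl//; lra.
have ZE : Z ^+ q.+1 = Z ^+ q * X + Z ^+ q * (4 * K * Y) by rewrite exprSr mulrDr.
(* Each of [h1] and [h2] absorbs one error term with coefficient [4 * K]. Their average has
   coefficients [2 * K], which covers both terms at once; this is the origin of the constant 4. *)
have h1 : X ^+ q.+1 + 4 * K * (X ^+ q * Y) <= Z ^+ q.+1.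
  rewrite ZE exprSr lerD ?ler_wpM2r//.
  by rewrite mulrCA ler_wpM2r.
have h2 : X ^+ q.+1 + 4 * K * Y ^+ q.+1 <= Z ^+ q.+1.
  rewrite ZE !exprSr lerD ?ler_wpM2r//.
  by rewrite mulrCA ler_wpM2r.
have : 0 <= K * Y ^+ q.+1 by rewrite mulr_ge0//; lra.
move: h1 h2; move: (X ^+ q.+1) (X ^+ q * Y) (Y ^+ q.+1) (Z ^+ q.+1) => a b c d; lra.
Qed.

(** Iterates [mean01_martingale_step]: since [D] is nondecreasing, the sum of the blocks before [J]
    has frequencies at most [D J]. The positive [X] bounds the empty sum, because the step asks for
    strictly positive bounds. *)
Lemma mean01_martingale_sum (q : nat) : exists2 K : R, 0 <= K &
  forall (F : nat -> R -> R[i]) (D : nat -> nat) (X : R) (Y : nat -> R),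
  0 < X -> (forall j, 0 < Y j) -> (forall j, (D j <= D j.+1)%N) ->
  (forall j, band [set m : int | (q.*2.+1 * D j < `|m| <= D j.+1)%N] (F j)) ->
  (forall j, mean01 (fun x => sqmod (F j x) ^+ q.+1) <= Y j ^+ q.+1) ->
  forall J, mean01 (fun x => sqmod (\sum_(j < J) F j x) ^+ q.+1) <=
    (X + K * \sum_(j < J) Y j) ^+ q.+1.
Proof.
have [K K0 HK] := mean01_martingale_step q.
exists K => // F D X Y X0 Y0 D_le bF FY; elim=> [|J IH].
  under [X in mean01 X]eq_fun do rewrite big_ord0 sqmod0 expr0n/=.
  by rewrite mean01_cst exprn_ge0// big_ord0 mulr0 addr0 ltW.
under [X in mean01 X]eq_fun do rewrite big_ord_recr/=.
rewrite big_ord_recr/= mulrDr addrA; apply: HK (IH) (FY J) => //.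
- rewrite ltr_wpDr// mulr_ge0// sumr_ge0// => j _; exact/ltW.
- apply: band_sum => j _ _; apply: sub_band (bF j) => m /= /andP[_ /leq_trans]; apply.
  exact: (homo_leq leqnn (fun _ _ _ => @leq_trans _ _ _) D_le).
- by apply: sub_band (bF J) => m /= /andP[].
Qed.

End SquareFunction.

(** * Growth of lacunary sequences and the leading term of a signed sum *)

Section Lacunary.
Variables (R : realType) (lam : R) (n : nat -> nat).
Hypotheses (lam1 : 1 < lam) (lac : lacunary lam n).

Lemma lacunary_ge (i k : nat) : lam ^+ k * (n i)%:R <= (n (i + k)%N)%:R.
Proof.
have [n0 nS] := lac; elim: k => [|k IH]; first by rewrite addn0 mul1r.
rewrite addnS; apply: (@le_trans _ _ (lam * (n (i + k)%N)%:R)).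
  by rewrite exprS -mulrA ler_wpM2l// (le_trans ler01 (ltW lam1)).
by have := ltW (nS (i + k)%N); rewrite ler_pdivlMr ?ltr0n.
Qed.

Lemma lacunary_tail_le (i j k : nat) : (i + j <= k)%N ->
  (n i)%:R <= lam ^- j * (n k)%:R :> R.
Proof.
move=> ijk; have l0 : 0 < lam by exact: lt_trans lam1.
rewrite ler_pdivlMl ?exprn_gt0//.
have -> : k = (i + (j + (k - (i + j))))%N by rewrite addnA subnKC.
apply: le_trans (lacunary_ge i _).
by rewrite ler_wpM2r// ler_weXn2l ?(ltW lam1)// leq_addr.
Qed.

(** The triple [e] holds the leading sign, the leading index and the remainder. Strictly decreasing
    indices fall by at least one per position, so the term in position [j + 1] is at most
    [lam ^- j.+1] times the leading one. *)
Lemma signed_sumsS (l : nat) (m : int) : signed_sums n l.+1 m ->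
  exists e : int * nat * int, [/\ e.1.1 = 1 \/ e.1.1 = -1,
    signed_sums n l e.2,
    m = e.1.1 * (n e.1.2)%:Z + e.2 &
    `|e.2|%:~R <= (\sum_(j < l) lam ^- j.+1) * (n e.1.2)%:R].
Proof.
move=> [eps [k [epsP kP ->]]].
exists (eps ord0, k ord0,
  \sum_(j < l) eps (lift ord0 j) * (n (k (lift ord0 j)))%:Z) => /=; split => //.
- exists (eps \o lift ord0), (k \o lift ord0); split => //= i j ij.
  by apply: kP; rewrite !lift0.
- by rewrite big_ord_recl.
have kj (j : 'I_l.+1) : (k j + j <= k ord0)%N.
  case: j => j; elim: j => [|j IH] jl.
    by rewrite addn0; have -> : Ordinal jl = ord0 by exact: val_inj.
  have jl' : (j < l.+1)%N by exact: ltnW.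
  have := kP (Ordinal jl') (Ordinal jl) (ltnSn j).
  by move: (IH jl') => /=; lia.
rewrite mulr_suml.
apply: (@le_trans _ _ (\sum_(j < l) (n (k (lift ord0 j)))%:R)); last first.
  apply: ler_sum => j _; apply: lacunary_tail_le.
  by have := kj (lift ord0 j); rewrite lift0.
rewrite -[leRHS](_ : (\sum_(j < l) (n (k (lift ord0 j)))%:Z)%:~R = _); last first.
  by rewrite rmorph_sum.
rewrite ler_int; apply: le_trans (ler_norm_sum _ _ _) _; apply: ler_sum => j _.
by rewrite normrM; case: (epsP (lift ord0 j)) => ->; rewrite ?normrN normr1 mul1r.
Qed.

End Lacunary.

(** Bernoulli's inequality for [lam = 1 + t]. The exponent is a successor because it later serves as
    a modulus. *)
Lemma expr_unbounded (R : realType) (lam M : R) : 1 < lam ->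
  exists N : nat, M < lam ^+ N.+1.
Proof.
move=> lam1; pose t := lam - 1.
have t0 : 0 < t by rewrite subr_gt0.
have bern N : 1 + t *+ N <= lam ^+ N.
  elim: N => [|N IH]; first by rewrite mulr0n addr0.
  rewrite exprS; apply: (@le_trans _ _ (lam * (1 + t *+ N))); last first.
    by rewrite ler_wpM2l// (le_trans ler01 (ltW lam1)).
  have -> : lam = 1 + t by rewrite /t addrC subrK.
  rewrite mulrSr mulrDl mul1r mulrDr mulr1.
  have : 0 <= t * t *+ N by rewrite mulrn_wge0 ?mulr_ge0 ?ltW.
  by rewrite mulrnAr; lra.
exists (Num.trunc (M / t)).+1; apply: lt_le_trans (bern _).
rewrite ltr_wpDl//; rewrite -mulr_natr mulrC -ltr_pdivrMr//.
apply: lt_trans (truncnS_gt _) _.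
by rewrite ltr_nat.
Qed.

(** * The role of the threshold on [lam] *)

Section Threshold.
Variable R : realType.

(** Dividing the equation of the threshold [t] by [t ^+ l.-1] shows that the sum of [t ^- j.+1] over
    [j < l.-1] is 1, and replacing [t] by a larger [lam] strictly decreases it. For [l = 2] the sum
    is just [lam^-1]. *)
Lemma threshold_tail_lt1 (l : nat) (lam : R) : (2 <= l)%N -> threshold R l < lam ->
  1 < lam /\ \sum_(j < l.-1) lam ^- j.+1 < 1.
Proof.
rewrite leq_eqVlt => /predU1P[<-|l3].
  rewrite /threshold eqxx => lam1; split => //.
  by rewrite big_ord1 expr1 invf_lt1// (lt_trans ltr01).
have [t1 tE] := (threshold_eqE (threshold R l) l3).2 erefl.
move: t1 tE; set t := threshold R l => t1 tE tlam.
split; first exact: lt_trans tlam.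
have t0 : 0 < t by exact: lt_trans t1.
apply: (@lt_le_trans _ _ (\sum_(j < l.-1) t ^- j.+1)).
  apply: ltr_sum => [|i _].
    by case: l l3 {t tE t1 tlam t0} => [|[|l]]// _; apply/hasP; exists ord0; rewrite ?mem_index_enum.
  rewrite ltf_pV2 ?posrE ?exprn_gt0//; last exact: lt_trans tlam.
  by rewrite ltrXn2r// ltW.
have tl : 0 < t ^+ l.-1 by rewrite exprn_gt0.
rewrite -(ler_pM2r tl) mul1r {2}tE mulr_suml (reindex_inj rev_ord_inj)/=.
rewrite le_eqVlt; apply/orP; left; apply/eqP; apply: eq_bigr => i _.
have il := ltn_ord i.
rewrite mulrC -exprB ?unitfE ?gt_eqF//; last by rewrite subnSK// leq_subr.
by congr (t ^+ _); lia.
Qed.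

End Threshold.

(** * Regrouping sums and adding boundedly many polynomials *)

Lemma big_fiber (V : nmodType) (I : eqType) (s : seq I) (P : pred I)
    (h : I -> nat) (J : nat) (X : I -> V) : (forall i, i \in s -> (h i < J)%N) ->
  \sum_(i <- s | P i) X i = \sum_(j < J) \sum_(i <- s | P i && (h i == j)) X i.
Proof.
move=> hJ; rewrite (exchange_big_dep P)/= => [|j i _ /andP[]//].
rewrite big_seq_cond [RHS]big_seq_cond; apply: eq_bigr => i /andP[/hJ iJ Pi].
rewrite (big_pred1 (Ordinal iJ)) => // j.
by rewrite /= Pi -val_eqE/= eq_sym.
Qed.

Section Combine.
Variable R : realType.
Implicit Types (f g : R -> R[i]) (A : set int).

Lemma exprD_le (a b : R) (q : nat) : 0 <= a -> 0 <= b ->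
  (a + b) ^+ q <= 2 ^+ q * (a ^+ q + b ^+ q).
Proof.
wlog ab : a b / a <= b => [H a0 b0|a0 b0].
  have [/H|/ltW/H {}H] := leP a b; first exact.
  by rewrite addrC [X in _ * X]addrC H.
apply: (@le_trans _ _ ((2 * b) ^+ q)); first by rewrite lerXn2r ?nnegrE ?addr_ge0//; lra.
by rewrite exprMn ler_wpM2l ?exprn_ge0// lerDr exprn_ge0.
Qed.

Lemma exprD_ge (a b : R) (q : nat) : 0 <= a -> 0 <= b ->
  a ^+ q.+1 + b ^+ q.+1 <= (a + b) ^+ q.+1.
Proof.
move=> a0 b0; rewrite [leRHS]exprSr mulrDr !exprSr lerD// ler_wpM2r//;
  by rewrite lerXn2r ?nnegrE ?addr_ge0// ?lerDl ?lerDr.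
Qed.

Lemma sqmodD_le (z w : R[i]) : sqmod (z + w) <= 2 * (sqmod z + sqmod w).
Proof.
rewrite -subr_ge0 (_ : _ - _ = sqmod (z - w)) ?sqmod_ge0//.
by case: z w => [a b] [c d]; rewrite /sqmod/=; ring.
Qed.

(** A crude triangle inequality in which [X] and [Y] bound squared norms. One factor 2 comes from
    [sqmodD_le], the other from [exprD_le], and [exprD_ge] merges the two powers. *)
Lemma mean01_sqmodD A f g (q : nat) (X Y : R) : 0 <= X -> 0 <= Y ->
  band A f -> band A g ->
  mean01 (fun x => sqmod (f x) ^+ q.+1) <= X ^+ q.+1 ->
  mean01 (fun x => sqmod (g x) ^+ q.+1) <= Y ^+ q.+1 ->
  mean01 (fun x => sqmod (f x + g x) ^+ q.+1) <= (4 * (X + Y)) ^+ q.+1.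
Proof.
move=> X0 Y0 bf bg fX gY.
have cf := continuous_sqmodX (q := q.+1) bf.
have cg := continuous_sqmodX (q := q.+1) bg.
apply: (@le_trans _ _ (4 ^+ q.+1 * (X ^+ q.+1 + Y ^+ q.+1))); last first.
  by rewrite exprMn ler_wpM2l ?exprn_ge0//; exact: exprD_ge.
apply: (@le_trans _ _ (mean01 (fun x => 4 ^+ q.+1 *
    (sqmod (f x) ^+ q.+1 + sqmod (g x) ^+ q.+1)))).
  apply: le_mean01 => [||x].
  - by apply: continuous_sqmodX (bandD bf bg).
  - exact/continuous_funZ/continuous_funD.
  - apply: (@le_trans _ _ ((2 * (sqmod (f x) + sqmod (g x))) ^+ q.+1)).
      rewrite lerXn2r ?nnegrE ?sqmod_ge0// ?sqmodD_le// mulr_ge0//.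
      by rewrite addr_ge0 ?sqmod_ge0.
    rewrite exprMn (_ : 4 = 2 * 2 :> R); last by ring.
    rewrite [in leRHS]exprMn -[leRHS]mulrA ler_wpM2l ?exprn_ge0//.
    exact: exprD_le (sqmod_ge0 _) (sqmod_ge0 _).
rewrite mean01Z; last exact: continuous_funD.
by rewrite mean01D// ler_wpM2l ?exprn_ge0// lerD.
Qed.

(** Applied to the residue classes of leading indices. Their number is fixed before the sequence is
    given, so the geometric growth of [C] under [C -> 4 * (C + 1)] is harmless. *)
Lemma mean01_sqmod_sum (q N : nat) : exists2 C : R, 0 <= C &
  forall (F : nat -> R -> R[i]) A (X : R), 0 <= X -> (forall i, band A (F i)) ->
  (forall i, mean01 (fun x => sqmod (F i x) ^+ q.+1) <= X ^+ q.+1) ->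
  mean01 (fun x => sqmod (\sum_(i < N) F i x) ^+ q.+1) <= (C * X) ^+ q.+1.
Proof.
elim: N => [|N [C C0 IH]].
  exists 0 => // F A X X0 bF FX.
  under [X in mean01 X]eq_fun do rewrite big_ord0 sqmod0 expr0n/=.
  by rewrite mean01_cst mul0r expr0n.
exists (4 * (C + 1)) => [|F A X X0 bF FX]; first by lra.
under [X in mean01 X]eq_fun do rewrite big_ord_recr/=.
rewrite -mulrA [(C + 1) * X]mulrDl mul1r.
have bS : band A (fun x => \sum_(i < N) F i x).
  by apply: band_sum => i _ _; exact: bF.
apply: (mean01_sqmodD _ X0 bS (bF N) _ (FX N)); first by rewrite mulr_ge0.
exact: IH bF FX.
Qed.

Lemma mean01_sqmod_harmM f (q : nat) (d : int) :
  mean01 (fun x => sqmod (harm d x * f x) ^+ q) = mean01 (fun x => sqmod (f x) ^+ q).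
Proof. by under [X in mean01 X]eq_fun do rewrite sqmodM sqmod_harm mul1r. Qed.

End Combine.

(** * The inequality for a set of frequencies, and its invariance under translation *)

Section SignedSums.
Variables (R : realType) (q : nat).

Definition tpoly (s : seq int) (c : int -> R[i]) (P : pred int) (x : R) : R[i] :=
  \sum_(m <- s | P m) c m * harm m x.

(** For a duplicate-free [s] and [P = xpredT] this is the squared L^2 norm of [tpoly s c P], by
    [parseval]. *)
Definition energy (s : seq int) (c : int -> R[i]) (P : pred int) : R :=
  \sum_(m <- s | P m) sqmod (c m).

Lemma energy_ge0 s c P : 0 <= energy s c P.
Proof. by apply: sumr_ge0 => m _; exact: sqmod_ge0. Qed.

Lemma energy_eq0 s c : energy s c xpredT = 0 -> tpoly s c xpredT = fun=> 0.
Proof.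
move/eqP; rewrite psumr_eq0 => [/allP c0|m _]; last exact: sqmod_ge0.
apply/funext => x; rewrite /tpoly big_seq big1// => m /c0/eqP/sqmod_eq0 ->.
by rewrite mul0r.
Qed.

Lemma tpoly_band (s : seq int) c (P : pred int) (A : set int) : (forall m, m \in s -> P m -> A m) ->
  band A (tpoly s c P).
Proof. by move=> sA; apply: band_sum => m ms Pm; apply/band_harm/sA. Qed.

(* [Lq_bound K S] states that ||f||_p <= K^(1/2) ||f||_2 with p = 2q + 2 for all
   trigonometric polynomials f with frequencies in S. *)
Definition Lq_bound (K : R) (S : set int) := forall (s : seq int) (c : int -> R[i]),
  uniq s -> (forall m, m \in s -> S m) ->
  mean01 (fun x => sqmod (tpoly s c xpredT x) ^+ q.+1) <=
  (K * energy s c xpredT) ^+ q.+1.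

(** Multiplication by a harmonic translates the spectrum but changes neither the modulus nor the
    coefficients. The bound is therefore applied to the selected frequencies moved by [- d]. *)
Lemma Lq_bound_shift K (S : set int) (s : seq int) c (P : pred int) (d : int) : Lq_bound K S -> uniq s ->
  (forall m, m \in s -> P m -> S (m - d)) ->
  mean01 (fun x => sqmod (tpoly s c P x) ^+ q.+1) <= (K * energy s c P) ^+ q.+1.
Proof.
move=> KS us sS; pose t := [seq m - d | m <- s & P m].
pose c' m := c (m + d).
have ut : uniq t by rewrite map_inj_uniq ?filter_uniq//; exact: addIr.
have tS m : m \in t -> S m.
  by case/mapP => a; rewrite mem_filter => /andP[Pa sa] ->; exact: sS.
have := KS t c' ut tS.
rewrite /energy big_map big_filter.
under [in leRHS]eq_bigr do rewrite /c' subrK.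
apply: le_trans; rewrite -(mean01_sqmod_harmM (tpoly t _ _) _ d) le_eqVlt.
apply/orP; left; apply/eqP; congr mean01; apply/funext => x; congr (sqmod _ ^+ _).
rewrite /tpoly big_map big_filter mulr_sumr; apply: eq_bigr => m _.
by rewrite /c' subrK mulrCA -harmD addrC subrK.
Qed.

Lemma energy_sum_fiber s c (h : int -> nat) J P :
  \sum_(j < J) energy s c (fun m => P m && (h m == j)) <= energy s c xpredT.
Proof.
rewrite /energy (exchange_big_dep xpredT)//=; apply: ler_sum => m _.
have [/existsP[j Pj]|/existsPn h0] := boolP [exists j : 'I_J, P m && (h m == j)].
  rewrite (big_pred1 j)// => i; case/andP: Pj => -> /eqP->.
  by rewrite /= -val_eqE/= eq_sym.
by rewrite big1 ?sqmod_ge0// => j; rewrite (negbTE (h0 j)).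
Qed.

End SignedSums.

Lemma signed_sums0 (n : nat -> nat) (m : int) : signed_sums n 0 m -> m = 0.
Proof. by move=> [eps [k [_ _ ->]]]; rewrite big_ord0. Qed.

(** The only available frequency is 0, so a duplicate-free list has at most one entry and the
    modulus is constant. *)
Lemma Lq_bound0 (R : realType) (q : nat) (n : nat -> nat) :
  @Lq_bound R q 1 (signed_sums n 0).
Proof.
move=> [|m [|m' s]] c us sS.
- rewrite /tpoly; under [X in mean01 X]eq_fun do rewrite big_nil sqmod0 expr0n/=.
  by rewrite mean01_cst /energy big_nil mulr0 expr0n.
- rewrite /tpoly /energy big_seq1 mul1r.
  under [X in mean01 X]eq_fun do rewrite big_seq1 sqmodM sqmod_harm mulr1.
  by rewrite mean01_cst.
- move: us => /=; rewrite (signed_sums0 (sS m _)) ?mem_head//.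
  by rewrite (signed_sums0 (sS m' _)) ?inE ?eqxx ?orbT.
Qed.

(** * Induction on the number of terms in the signed sums *)

Section Induction.
Variables (R : realType) (lam : R).
Hypothesis lam1 : 1 < lam.

Lemma lacunary_homo (n : nat -> nat) (i j : nat) : lacunary lam n ->
  (i <= j)%N -> (n i <= n j)%N.
Proof.
move=> lac /subnKC <-; rewrite -(ler_nat R).
apply: le_trans (lacunary_ge lam1 lac _ _).
by rewrite ler_peMl// exprn_ege1// ltW.
Qed.

(** An integer may have several representations; one is chosen for each [m], and [k m] then decides
    the block of [m]. The remainder is at most the tail sum times the leading term, hence smaller
    than it, which gives both bounds on [|m|]. *)
Lemma signed_sums_decomp (n : nat -> nat) (l : nat) (s : seq int) :
  lacunary lam n -> \sum_(j < l) lam ^- j.+1 < 1 ->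
  (forall m, m \in s -> signed_sums n l.+1 m) ->
  exists (e : int -> int) (k : int -> nat), forall m, m \in s ->
  [/\ e m = 1 \/ e m = -1, signed_sums n l (m - e m * (n (k m))%:Z) &
      (1 - \sum_(j < l) lam ^- j.+1) * (n (k m))%:R <= (`|m|%N%:R : R)
      <= 2 * (n (k m))%:R].
Proof.
move=> lac lamS sS; set d := \sum_(j < l) lam ^- j.+1.
have /choice[f fP] : forall m, exists e : int * nat, m \in s ->
    [/\ e.1 = 1 \/ e.1 = -1, signed_sums n l (m - e.1 * (n e.2)%:Z) &
      (1 - d) * (n e.2)%:R <= (`|m|%N%:R : R) <= 2 * (n e.2)%:R].
  move=> m; have [ms|ms] := boolP (m \in s); last by exists (1, 0%N).
  have [[[e k] m']/= [eP m'S mE m'le]] := signed_sumsS lam1 lac (sS m ms).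
  exists (e, k) => _ /=; split => //; first by rewrite mE addrC addKr.
  rewrite natr_absz.
  have mR : m%:~R = e%:~R * (n k)%:R + m'%:~R :> R by rewrite mE rmorphD/= rmorphM.
  move: m'le; rewrite !intr_norm mR -/d.
  have nk : 0 <= (n k)%:R :> R by [].
  have dn : d * (n k)%:R <= 1 * (n k)%:R by rewrite ler_wpM2r// ltW.
  have eR : e%:~R = 1 :> R \/ e%:~R = -1 :> R.
    by case: eP => ->; [left|right; rewrite rmorphN].
  move: nk dn; move: (n k)%:R (m'%:~R : R) (e%:~R : R) eR => x y a eR nk dn.
  rewrite !ler_norml => /andP[h1 h2]; rewrite mulrBl mul1r.
  by case: eR => ->; rewrite ?mulN1r ?mul1r;
    [rewrite ger0_norm|rewrite ler0_norm]; lra.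
by exists (fst \o f), (snd \o f) => m /fP.
Qed.

(** All auxiliary constants are fixed before [n] is introduced, which makes [K] uniform over
    lacunary sequences. *)
Lemma Lq_bound_signed_sums (q l : nat) : \sum_(j < l.-1) lam ^- j.+1 < 1 ->
  exists2 K : R, 0 <= K &
  forall n, lacunary lam n -> Lq_bound q K (signed_sums n l).
Proof.
elim: l => [|l IH] lamS.
  by exists 1 => // n _; exact: Lq_bound0.
have {IH} [|K K0 HK] := IH.
  case: l lamS => [|l]/=; first by rewrite !big_ord0.
  by rewrite big_ord_recr/=; apply: le_lt_trans;
    rewrite lerDl invr_ge0 exprn_ge0// ltW// (lt_trans ltr01).
move: lamS => /= lamS; set d := \sum_(j < l) lam ^- j.+1 in lamS.
have d0 : 0 < 1 - d by rewrite subr_gt0.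
(* Along a residue class modulo [N.+1] the sequence grows at least by [lam ^+ N.+1]. With this
   choice, [1 - d] times a term exceeds [q.*2.+1] times twice the preceding term of the class, which
   is the separation of blocks required below. *)
have [N HN] := expr_unbounded (q.*2.+1%:R * 2 / (1 - d)) lam1.
have [C C0 HC] := @mean01_sqmod_sum R q N.+1.
have [K' K'0 HK'] := @mean01_martingale_sum R q.
(* [C] adds up the residue classes; inside a class, 1 comes from the initial value [sg], [4 * K]
   from joining the two signs in a block, and the last 1 from the slack in [Y]. *)
exists (C * (1 + K' * (4 * K + 1))).
  by rewrite mulr_ge0// addr_ge0// mulr_ge0// addr_ge0// mulr_ge0.
move=> n lac s c us sS.
have [e [k ekP]] := signed_sums_decomp lac lamS sS.
set sg := energy s c xpredT.
(* The energy [sg] will be the strictly positive initial value [X] of [mean01_martingale_sum], so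
   zero energy is treated apart. *)
have [sg0|sg0] := eqVneq sg 0.
  by rewrite (energy_eq0 sg0) sqmod0 mean01_cst expr0n/= sg0 mulr0 expr0n.
have {}sg0 : 0 < sg by rewrite lt_neqAle eq_sym sg0 energy_ge0.
pose J := (\max_(m <- s) k m).+1.
have kJ m : m \in s -> (k m < J)%N by move=> ms; rewrite ltnS leq_bigmax_seq.
pose Q r j := fun m => (k m %% N.+1 == r)%N && (k m %/ N.+1 == j)%N.
pose F r j := tpoly s c (Q r j).
have kQ r j m : Q r j m -> k m = (j * N.+1 + r)%N.
  by case/andP => /eqP <- /eqP <-; exact: divn_eq.
pose G r x := \sum_(j < J) F r j x.
(* Within a residue class [r] modulo [N.+1] the blocks [F r j] are separated
   well enough for [mean01_martingale_sum]. *)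
have FT r j : band setT (F r j) by exact: tpoly_band.
have GT r : band setT (G r) by apply: band_sum => j _ _; exact: FT.
have tE x : tpoly s c xpredT x = \sum_(r < N.+1) G r x.
  rewrite /tpoly (@big_fiber _ _ _ xpredT (fun m => k m %% N.+1)%N N.+1); last first.
    by move=> m _; rewrite ltn_mod.
  apply: eq_bigr => r _; apply: big_fiber => m /kJ; apply: leq_ltn_trans.
  exact: leq_div.
under [X in mean01 X]eq_fun do rewrite tE.
rewrite -mulrA; apply: (HC _ setT) => //.
  by rewrite mulr_ge0 ?energy_ge0// addr_ge0// mulr_ge0// addr_ge0// mulr_ge0.
move=> r.
(* [D j.+1] is the upper frequency bound of block [j]. The value 0 at the start only asks the first
   block to avoid the frequency 0. *)
pose D j := if j is j'.+1 then (2 * n (j' * N.+1 + r))%N else 0%N.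
(* The summand [sg / J] only serves to make every [Y j] positive. *)
pose Y j := 4 * (K * energy s c (Q r j)) + sg / J%:R.
have J0 : 0 < J%:R :> R by rewrite ltr0n.
have Y0 j : 0 < Y j.
  by rewrite ltr_wpDl ?divr_gt0// mulr_ge0// mulr_ge0// energy_ge0.
have sumY : \sum_(j < J) Y j <= (4 * K + 1) * sg.
  rewrite big_split/= sumr_const card_ord -[(_ / _) *+ _]mulr_natr divfK ?gt_eqF//.
  rewrite mulrDl mul1r lerD2r -!mulr_sumr -mulrA !ler_wpM2l//.
  exact: (energy_sum_fiber s c (fun m => k m %/ N.+1)%N J
    (fun m => k m %% N.+1 == r)%N).
have := @HK' (F r) D sg Y sg0 Y0.
have D_le j : (D j <= D j.+1)%N.
  by case: j => [|j]//=; rewrite leq_mul2l/= lacunary_homo//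
    leq_add2r leq_mul2r leqnSn orbT.
move/(_ D_le) => h.
apply: le_trans (h _ _ J) _; last first.
- have sg0' := ltW sg0.
  rewrite lerXn2r ?nnegrE//.
  + by rewrite addr_ge0// mulr_ge0// sumr_ge0// => j _; exact/ltW.
  + by rewrite mulr_ge0// addr_ge0// mulr_ge0// addr_ge0// mulr_ge0.
  + by rewrite mulrDl mul1r lerD2l -mulrA ler_wpM2l.
- move=> j; set kj := n (j * N.+1 + r)%N.
  (* All frequencies of the block share the leading term [kj]; the sign decides whether subtracting
     or adding it leads into [signed_sums n l], where the induction hypothesis applies. *)
  pose P1 m := Q r j m && (e m == 1); pose P2 m := Q r j m && (e m != 1).
  have FE x : F r j x = tpoly s c P1 x + tpoly s c P2 x.
    by rewrite /F /tpoly (bigID (fun m => e m == 1)).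
  have EE : energy s c (Q r j) = energy s c P1 + energy s c P2.
    by rewrite /energy (bigID (fun m => e m == 1)).
  have KE P : 0 <= K * energy s c P by rewrite mulr_ge0 ?energy_ge0.
  under [X in mean01 X]eq_fun do rewrite FE.
  apply: (@le_trans _ _ ((4 * (K * energy s c P1 + K * energy s c P2)) ^+ q.+1)).
    apply: (@mean01_sqmodD _ setT) => //.
    + exact: tpoly_band.
    + exact: tpoly_band.
    + apply: (Lq_bound_shift (d := kj%:Z) c (HK n lac) us) => m ms /andP[Qm /eqP em].
      by have [_ + _] := ekP m ms; rewrite (kQ _ _ _ Qm) em mul1r.
    + apply: (Lq_bound_shift (d := - kj%:Z) c (HK n lac) us) => m ms /andP[Qm /eqP em].
      have [eP + _] := ekP m ms; rewrite (kQ _ _ _ Qm).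
      by case: eP => // ->; rewrite mulN1r.
  have KE12 := addr_ge0 (KE P1) (KE P2).
  rewrite lerXn2r ?nnegrE ?(ltW (Y0 j)) ?(mulr_ge0 _ KE12)//.
  by rewrite -mulrDr -EE lerDl divr_ge0// ltW.
- move=> j; apply: tpoly_band => m ms Qm /=.
  have [_ _] := ekP m ms; rewrite (kQ _ _ _ Qm) -/d => /andP[lo hi].
  apply/andP; split; last by rewrite -(ler_nat R) natrM.
  rewrite -(ltr_nat R); apply: lt_le_trans lo.
  case: j {hi Qm} => [|j] /=.
    by rewrite muln0 mulr_gt0// ltr0n; case: lac.
  apply: (@lt_le_trans _ _ ((1 - d) * (lam ^+ N.+1 * (n (j * N.+1 + r)%N)%:R))).
    rewrite mulrA -ltr_pdivrMr ?ltr0n; last by case: lac.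
    rewrite !natrM mulrA mulfK ?pnatr_eq0 -?lt0n; last by case: lac.
    by rewrite [ltRHS]mulrC -ltr_pdivrMr.
  rewrite ler_wpM2l ?(ltW d0)// (_ : (j.+1 * _ + r = j * N.+1 + r + N.+1)%N).
    exact: lacunary_ge.
  by rewrite mulSn -addnA addnC.
Qed.
End Induction.

(** * Parseval's identity and the return to L^p norms *)

Section Norms.
Variable R : realType.
Implicit Types (f : R -> R[i]) (g : R -> R) (A : set int).

(** Induction on the list: the cross term between a new harmonic and the others has no zero
    frequency, because the list has no duplicates. *)
Lemma parseval (s : seq int) (c : int -> R[i]) : uniq s ->
  mean01 (fun x => sqmod (tpoly s c xpredT x)) = energy s c xpredT.
Proof.
elim: s => [|m s IH] /=.
  rewrite /tpoly /energy big_nil -[RHS](mean01_cst 0) => _.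
  by congr mean01; apply/funext => x; rewrite big_nil sqmod0.
case/andP => ms /IH {}IH; rewrite /energy big_cons -/(energy s c xpredT) -IH.
pose f x : R[i] := c m * harm m x; pose g := tpoly s c xpredT.
have bf : band [set m] f by exact: band_harm.
have bg : band [set m' | m' \in s] g by exact: tpoly_band.
have e x : sqmod (tpoly (m :: s) c xpredT x) =
    (sqmod (c m) + complex.Re (2 * conjc (f x) * g x)) + sqmod (g x).
  by rewrite /tpoly big_cons sqmodD sqmodM sqmod_harm mulr1 cross_Re.
under [X in mean01 X]eq_fun do rewrite e.
have bfg : band [set m | m != 0] (fun x => 2 * conjc (f x) * g x).
  have bcf : band [set - m] (fun x => conjc (f x)) by apply: band_conj bf => a ->.
  have b2cf : band [set - m] (fun x => 2 * conjc (f x)).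
    apply: bandM (@band_cst _ [set m : int | m = 0] 2 erefl) bcf => a b /= -> ->.
    by rewrite add0r.
  apply: bandM b2cf bg => a b /= -> bs; rewrite addrC subr_eq0.
  by apply: contraNneq ms => <-.
have cg : continuous (fun x => sqmod (g x)) by exact: continuous_sqmod bg.
have cfg := band_continuous_Re bfg.
rewrite mean01D//; last by apply: continuous_funD => // x; exact: cst_continuous.
by rewrite mean01D ?mean01_cst ?mean01_band ?addr0// => x; exact: cst_continuous.
Qed.

(** The norms live on the open interval and [mean01] on the closed one: the complement of the open
    interval is null for the restricted measure, and the endpoints are null for Lebesgue measure. *)
Lemma integral_lebesgue01 g : continuous g -> (forall x, 0 <= g x) ->
  (\int[lebesgue01 R]_x (g x)%:E = (mean01 g)%:E)%E.
Proof.
move=> cg g0.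
have mg : measurable_fun [set: R] (EFin \o g).
  by apply/measurable_EFinP; exact: continuous_measurable_fun.
have m01 : measurable (`]0, 1[%classic : set R) by exact: measurable_itv.
rewrite -[X in integral _ X _](setUv `]0, 1[%classic).
rewrite ge0_integral_setU//; last 4 first.
- exact: measurableC.
- by rewrite setUv.
- by move=> x _; rewrite lee_fin.
- by apply/disj_set2P; rewrite setICr.
rewrite [X in (_ + X)%E]null_set_integral; last 3 first.
- exact: measurableC.
- exact: measurable_funTS.
- by rewrite /lebesgue01 /= /mrestr setICl measure0.
rewrite adde0 (@eq_measure_integral _ _ _ _ (@lebesgue_measure R)); last first.
  by move=> S mS S01; rewrite /lebesgue01 /= /mrestr setIidl.
rewrite integral_itv_obnd_cbnd; last exact: measurable_funTS.
rewrite integral_itv_bndo_bndc; last exact: measurable_funTS.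
rewrite /mean01 /Rintegral fineK//; apply: integrable_fin_num => //.
exact: continuous_integrable01.
Qed.

Lemma normcE (z : R[i]) : ComplexField.Normc.normc z = Num.sqrt (sqmod z).
Proof. by case: z. Qed.

Lemma powR_le_add_expr (y r : R) (q : nat) : 0 <= y -> 0 <= r -> r <= q%:R ->
  y `^ r <= 1 + y ^+ q.
Proof.
move=> y0 r0 rq; have [y1|/ltW y1] := leP y 1.
  rewrite -[leLHS]addr0 lerD ?exprn_ge0//.
  have := @ge0_ler_powR R r r0 y 1; rewrite !nnegrE powR1; exact.
by rewrite -[leLHS]add0r lerD// -powR_mulrn// ler_powR.
Qed.

Lemma Lp01_2 A f : band A f ->
  (Lp01 2 f = ((mean01 (fun x => sqmod (f x)))%:E `^ 2^-1))%E.
Proof.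
move=> bf; rewrite /Lp01 unlock; congr poweR.
rewrite -integral_lebesgue01; last 2 first.
- exact: continuous_sqmod bf.
- by move=> x; exact: sqmod_ge0.
apply: eq_integral => x _; rewrite normcE /= ger0_norm ?sqrtr_ge0//.
by rewrite powR_mulrn ?sqrtr_ge0// sqr_sqrtr ?sqmod_ge0.
Qed.

(** Stands in for the monotonicity of L^p norms, with [sg] as the squared L^2 norm. For
    [y = |f|^2 / sg], the bound [y^(p/2) <= 1 + y^q] integrates to at most [1 + K]. *)
Lemma Lp01_le A f (q : nat) (p K sg : R) : 0 < p -> p <= q%:R *+ 2 -> 0 < sg ->
  band A f -> mean01 (fun x => sqmod (f x) ^+ q) <= K * sg ^+ q ->
  (Lp01 p f <= ((1 + K) `^ p^-1)%:E * sg%:E `^ 2^-1)%E.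
Proof.
move=> p0 pq sg0 bf fK.
have p20 : 0 <= p / 2 by rewrite divr_ge0// ltW.
pose g x := sg `^ (p / 2) * (1 + (sg ^+ q)^-1 * sqmod (f x) ^+ q).
have sgq : 0 < sg ^+ q by rewrite exprn_gt0.
have cf := @continuous_sqmodX _ _ _ q bf.
have cg : continuous g.
  apply/continuous_funZ/continuous_funD; last exact: continuous_funZ.
  by move=> x; exact: cst_continuous.
have g0 x : 0 <= g x.
  rewrite mulr_ge0 ?powR_ge0// addr_ge0// mulr_ge0 ?invr_ge0 ?exprn_ge0 ?(ltW sg0)//.
  exact: sqmod_ge0.
have gK : mean01 g <= sg `^ (p / 2) * (1 + K).
  rewrite mean01Z; last first.
    apply: continuous_funD; last exact: continuous_funZ.
    by move=> x; exact: cst_continuous.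
  rewrite ler_wpM2l ?powR_ge0// mean01D; last 2 first.
  - by move=> x; exact: cst_continuous.
  - exact: continuous_funZ.
  by rewrite mean01_cst lerD2l mean01Z// mulrC ler_pdivrMr.
have fE x : (`|(ComplexField.Normc.normc (f x))%:E| `^ p =
    (sqmod (f x) `^ (p / 2))%:E)%E.
  rewrite abse_EFin poweR_EFin normcE ger0_norm ?sqrtr_ge0//.
  by rewrite -powR12_sqrt ?sqmod_ge0// -powRrM mulrC.
have fg x : sqmod (f x) `^ (p / 2) <= g x.
  have y0 : 0 <= sqmod (f x) / sg by rewrite divr_ge0 ?sqmod_ge0 ?ltW.
  rewrite -[X in X `^ _](divfK (lt0r_neq0 sg0)) mulrC powRM ?(ltW sg0)//.
  rewrite ler_wpM2l ?powR_ge0//; apply: le_trans (@powR_le_add_expr _ _ q _ _ _) _ => //.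
    by rewrite ler_pdivrMr// -mulr_natr in pq *.
  by rewrite expr_div_n mulrC.
have K10 : 0 <= 1 + K.
  rewrite -(pmulr_rge0 _ (powR_gt0 (p / 2) sg0)); apply: le_trans gK.
  by apply: Rintegral_ge0.
have -> : (((1 + K) `^ p^-1)%:E * sg%:E `^ 2^-1 =
    ((sg `^ (p / 2) * (1 + K))%:E `^ p^-1))%E.
  rewrite !poweR_EFin -EFinM powRM ?powR_ge0// -powRrM mulrC; congr (_ * _ `^ _)%:E.
  by rewrite mulrAC mulfV ?mul1r// gt_eqF.
rewrite /Lp01 unlock.
have le1 : (\int[lebesgue01 R]_x (`|(ComplexField.Normc.normc (f x))%:E| `^ p) <=
    (sg `^ (p / 2) * (1 + K))%:E)%E.
  apply: (@le_trans _ _ (mean01 g)%:E); last by rewrite lee_fin.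
  rewrite -integral_lebesgue01//; under eq_integral do rewrite fE.
  apply: ge0_le_integral => //.
  - by move=> x _; rewrite lee_fin powR_ge0.
  - have mf : measurable_fun [set: R] (fun x : R => sqmod (f x)).
      by apply: continuous_measurable_fun; exact: continuous_sqmod bf.
    by apply/measurable_EFinP; exact: (measurableT_comp (measurable_powR (p / 2)) mf).
  - by apply/measurable_EFinP; exact: continuous_measurable_fun.
  - by move=> x _; rewrite lee_fin.
apply: gt0_ler_poweR => //.
- by rewrite invr_ge0 ltW.
- by rewrite in_itv/= leey andbT integral_ge0// => x _; exact: poweR_ge0.
- by rewrite in_itv/= leey andbT lee_fin mulr_ge0 ?powR_ge0.
Qed.
End Norms.

(** * Finitely supported sums as lists, and assembly of the estimate *)

Lemma trig_sum_tpoly (R : realType) (A : set int) (c : int -> R[i]) :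
  finite_set [set m | A m /\ c m != 0] ->
  exists s : seq int, [/\ uniq s, (forall m, m \in s -> A m) &
    trig_sum A c = tpoly s c xpredT].
Proof.
move=> fA; exists (finmap.enum_fset (fset_set [set m | A m /\ c m != 0]));
  split => [|m|].
- exact: finmap.fset_uniq.
- by rewrite in_fset_set// inE => -[].
apply/funext => x; rewrite /trig_sum /tpoly -fsbig_finite//.
apply/esym/fsbig_widen => m /=; first by case.
by case=> Am /not_andP[//|/negP/negPn/eqP->]; rewrite mul0r.
Qed.

Unset Implicit Arguments.

Theorem theorem1p1 (R : realType) (l : nat) (lam p : R) :
  (2 <= l)%N -> threshold R l < lam -> 2 < p ->
  exists C : R, forall (n : nat -> nat) (c : int -> R[i]),
    lacunary lam n ->
    finite_set [set m | signed_sums n l m /\ c m != 0] ->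
    (Lp01 p (trig_sum (signed_sums n l) c) <=
     C%:E * Lp01 2 (trig_sum (signed_sums n l) c))%E.
Proof.
move=> l2 /(threshold_tail_lt1 l2)[lam1 lamS] p2.
have p0 : 0 < p by exact: lt_trans p2.
(* The even exponent [2 * q.+1] has to be at least [p] and to depend on [p] alone. *)
pose q := Num.trunc p.
have pq : p <= q.+1%:R *+ 2.
  apply: le_trans (ltW (truncnS_gt p)) _.
  by rewrite mulr2n lerDl.
have [K K0 HK] := Lq_bound_signed_sums lam1 q lamS.
(* The constant of [Lp01_le], with [K ^+ q.+1] for its [K], since [Lq_bound] keeps [K] inside the
   power. *)
exists ((1 + K ^+ q.+1) `^ p^-1) => n c lac fin.
have [s [us sA ->]] := trig_sum_tpoly fin.
have bT : band setT (tpoly s c xpredT) by exact: tpoly_band.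
rewrite (Lp01_2 bT) parseval//.
(* [Lp01_le] requires a positive energy; when it is 0 the sum vanishes identically and its L^p norm
   is 0. *)
have [e0|e0] := eqVneq (energy s c xpredT) 0.
  rewrite (energy_eq0 e0).
  rewrite /Lp01 (_ : (fun _ => _) = cst 0%E); last first.
    by apply/funext => x; rewrite ComplexField.Normc.normc0.
  rewrite Lnorm0 ?mule_ge0 ?poweR_ge0 ?lee_fin ?powR_ge0//.
  by rewrite eqe gt_eqF.
apply: Lp01_le pq _ bT _ => //.
  by rewrite lt_neqAle eq_sym e0 energy_ge0.
by rewrite -exprMn; exact: (HK n lac s c us sA).
Qed.
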